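(* Let $k\geq 2$ be an integer and, for $n\geq 0$, let $a_{k,n}$ denote the number of weakly even-up words over $k$ of length $n$. Let $A_k(x)=\sum_{n\geq 0}a_{k,n}x^n$. Then \[A_k(x)=\begin{cases}\dfrac{1}{(1-x)^{\frac{k+2}{2}}+(1-x)^{\frac{k+2}{2}-1}+x-1}, & \text{if } k \text{ is even};\\[2ex] \dfrac{1}{(1-x)^{\frac{k+1}{2}}+(1-x)^{\frac{k+1}{2}-1}-1}, & \text{if } k \text{ is odd}.\end{cases}\]
   Context: For an integer $k\geq 2$, let $[k]=\{1,\ldots,k\}$. A word over $k$ of length $n$ is an element $w_1\cdots w_n\in[k]^n$ (for $n=0$ there is exactly one word, the empty word). A word $w_1\cdots w_n\in[k]^n$ is weakly even-up if for every $i\in[n-1]$, whenever $w_i$ is even, $w_{i+1}\geq w_i$. *)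

(* Defs.v *)
From HB Require Import structures.
From mathcomp Require Import all_boot all_order all_algebra.
From mathcomp Require Import boolp.
Set Implicit Arguments.
Unset Strict Implicit.
Unset Printing Implicit Defensive.
Import GRing.Theory.
Local Open Scope ring_scope.

(* The wrapper keeps the Cauchy product apart from the pointwise ring structure
   that functions [nat -> R] may carry. *)
Record fps (R : Type) := FPS { fps_coef : nat -> R }.
Arguments FPS {R}.
Add Printing Constructor fps.

HB.instance Definition _ (R : Type) := gen_eqMixin (fps R).
HB.instance Definition _ (R : Type) := gen_choiceMixin (fps R).

Lemma fpsP (R : Type) (f g : fps R) :
  (forall n, fps_coef f n = fps_coef g n) -> f = g.
Proof. by case: f g => [f] [g] /= fg; congr FPS; exact/funext. Qed.

Section FpsRing.
Variable R : comNzRingType.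
Implicit Types f g h : fps R.

Definition fps0 : fps R := FPS (fun=> 0).
Definition fps_add f g := FPS (fun n => fps_coef f n + fps_coef g n).
Definition fps_opp f := FPS (fun n => - fps_coef f n).

Fact fps_addA : associative fps_add.
Proof. by move=> f g h; apply: fpsP => n; apply: addrA. Qed.
Fact fps_addC : commutative fps_add.
Proof. by move=> f g; apply: fpsP => n; apply: addrC. Qed.
Fact fps_add0 : left_id fps0 fps_add.
Proof. by move=> f; apply: fpsP => n; apply: add0r. Qed.
Fact fps_addN : left_inverse fps0 fps_opp fps_add.
Proof. by move=> f; apply: fpsP => n; apply: addNr. Qed.

HB.instance Definition _ :=
  GRing.isZmodule.Build (fps R) fps_addA fps_addC fps_add0 fps_addN.

Definition fps1 : fps R := FPS (fun n => (n == 0)%:R).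
Definition fps_mul f g :=
  FPS (fun n => \sum_(i < n.+1) fps_coef f i * fps_coef g (n - i)).

Definition fps_trunc m f : {poly R} := \poly_(i < m.+1) fps_coef f i.

Lemma coef_fps_trunc m f n : (n <= m)%N -> (fps_trunc m f)`_n = fps_coef f n.
Proof. by move=> nm; rewrite coef_poly ltnS nm. Qed.

Lemma fps_coefM_trunc m f g n : (n <= m)%N ->
  fps_coef (fps_mul f g) n = (fps_trunc m f * fps_trunc m g)`_n.
Proof.
move=> nm; rewrite coefM /=; apply: eq_bigr => i _.
by rewrite !coef_fps_trunc // (leq_trans _ nm) ?leq_subr // -ltnS.
Qed.

Fact fps_mulA : associative fps_mul.
Proof.
move=> f g h; apply: fpsP => n.
transitivity ((fps_trunc n f * (fps_trunc n g * fps_trunc n h))`_n).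
  rewrite coefM /=; apply: eq_bigr => i _.
  have le_in : (i <= n)%N by rewrite -ltnS.
  by rewrite (coef_fps_trunc _ le_in) -(fps_coefM_trunc _ _ (leq_subr i n)).
rewrite mulrA coefM /=; apply: eq_bigr => i _.
have le_in : (i <= n)%N by rewrite -ltnS.
by rewrite coef_fps_trunc ?leq_subr // -(fps_coefM_trunc _ _ le_in).
Qed.
Fact fps_mulC : commutative fps_mul.
Proof.
by move=> f g; apply: fpsP => n; rewrite !(fps_coefM_trunc _ _ (leqnn n)) mulrC.
Qed.
Fact fps_mul1 : left_id fps1 fps_mul.
Proof.
move=> f; apply: fpsP => n /=.
by rewrite big_ord_recl /= mul1r subn0 big1 ?addr0 // => i _; rewrite mul0r.
Qed.
Fact fps_mulDl : left_distributive fps_mul fps_add.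
Proof.
move=> f g h; apply: fpsP => n /=.
by rewrite -big_split; apply: eq_bigr => i _; rewrite mulrDl.
Qed.
Fact fps_1neq0 : fps1 != 0.
Proof.
by apply/eqP => /(congr1 (fun f => fps_coef f 0)) /= /eqP; rewrite oner_eq0.
Qed.

HB.instance Definition _ := GRing.Zmodule_isComNzRing.Build (fps R)
  fps_mulA fps_mulC fps_mul1 fps_mulDl fps_1neq0.

Definition fps_unit : pred (fps R) := fun f => `[< exists g, g * f = 1 >].
(* Noninvertible series are their own inverse, as [GRing.inv] requires. *)
Definition fps_inv f : fps R :=
  if pselect (exists g, g * f = 1) is left fV then projT1 (cid fV) else f.

Fact fps_mulV : {in fps_unit, left_inverse 1 fps_inv *%R}.
Proof.
move=> f /asboolP fV; rewrite /fps_inv; case: pselect => // e.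
by case: (cid e).
Qed.
Fact fps_unitP f g : g * f = 1 -> fps_unit f.
Proof. by move=> gf; apply/asboolP; exists g. Qed.
Fact fps_inv_out : {in [predC fps_unit], fps_inv =1 id}.
Proof. by move=> f /asboolP fV; rewrite /fps_inv; case: pselect. Qed.

HB.instance Definition _ := GRing.ComNzRing_hasMulInverse.Build (fps R)
  fps_mulV fps_unitP fps_inv_out.

End FpsRing.

Lemma fps_unitE (R : comUnitRingType) (f : fps R) :
  (f \is a GRing.unit) = (fps_coef f 0 \is a GRing.unit).
Proof.
apply/idP/idP => [/mulVr /(congr1 (fun h => fps_coef h 0)) /= | f0].
  by rewrite big_ord1 subnn mulrC => f0; apply/unitrPr; exists (fps_coef f^-1 0).
pose c := fps_coef f; pose next n (s : seq R) : R :=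
  - (c 0)^-1 * \sum_(i < n.+1) c i.+1 * s`_i.
pose s := fix s n := if n is m.+1 then next m (s m) :: s m else [:: (c 0)^-1].
have nth_s n i : (i <= n)%N -> (s n)`_i = (s (n - i)%N)`_0.
  elim: n i => [|n IH] [|i] //.
  by rewrite ltnS subSS => /IH.
apply/unitrPr; exists (FPS (fun n => (s n)`_0)); apply: fpsP => -[|n].
  by rewrite /= big_ord1 /= mulrV.
rewrite /= big_ord_recl /= -/c /next mulrA mulrN mulrV // mulN1r addrC.
apply/eqP; rewrite subr_eq0; apply/eqP; apply: eq_bigr => i _.
by have le_in := ltn_ord i; rewrite ltnS in le_in; rewrite (nth_s _ _ le_in).
Qed.

Definition fpsX (R : comNzRingType) : fps R := FPS (fun n => (n == 1)%:R).
Arguments fpsX {R}.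

(* [k] = {1, ..., k} is encoded by ['I_k], shifted by one. *)
Definition letter k (c : 'I_k) : nat := c.+1.

(* Quantifying over the successor position [j] leaves the last letter
   unconstrained. *)
Definition weakly_even_up k n (w : n.-tuple 'I_k) : bool :=
  [forall i : 'I_n, forall j : 'I_n,
    (j == i.+1 :> nat) && ~~ odd (letter (tnth w i)) ==>
    (letter (tnth w i) <= letter (tnth w j))%N].

Definition num_weakly_even_up k n : nat :=
  #|[set w : n.-tuple 'I_k | weakly_even_up w]|.

Definition weakly_even_up_gf k : fps rat :=
  FPS (fun n => (num_weakly_even_up k n)%:R).

(* Main.v *)
(* Letting [P a] count the words that may follow the letter [a], and [T c] the
   words that are empty or start with a letter at least [c], one has
   [T c = T (c+1) + x P c], where [P c] is [A = T 1] for odd [c] and [T c] for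
   even [c].  Hence [(1 - x) T (2i+1) = T (2i+3) + x (1 - x) A], and iterating
   from [T 1] up to [T (k+1) = 1] gives a linear equation for [A]. *)
Require Import Defs.
From HB Require Import structures.
From mathcomp Require Import all_boot all_order all_algebra.
From mathcomp Require Import boolp.
From mathcomp Require Import zify ring.
Import GRing.Theory.
Local Open Scope ring_scope.

Lemma card_path_tupleS (T : finType) (e : rel T) (a : T) n :
  #|[set w : n.+1.-tuple T | path e a w]| =
  (\sum_(b | e a b) #|[set w : n.-tuple T | path e b w]|)%N.
Proof.
rewrite -sum1_card (eq_bigr (fun b => \sum_(w : n.-tuple T | path e b w) 1)%N).
  rewrite pair_big_dep /=.
  rewrite (reindex (fun p : T * n.-tuple T => [tuple of p.1 :: p.2])) /=.
    by apply: eq_bigl => p; rewrite inE.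
  exists (fun w : n.+1.-tuple T => (thead w, [tuple of behead w])).
    by case=> b w _; rewrite theadE; congr pair; apply: val_inj.
  by move=> w _; rewrite [RHS]tuple_eta.
by move=> b _; rewrite -sum1_card; apply: eq_bigl => w; rewrite inE.
Qed.

Lemma card_path_tuple0 (T : finType) (e : rel T) (a : T) :
  #|[set w : 0.-tuple T | path e a w]| = 1%N.
Proof.
rewrite (_ : [set _ | _] = [set: 0.-tuple T]) ?cardsT ?card_tuple //.
by apply/setP => w; rewrite !inE tuple0.
Qed.

Lemma fps_coef_sum (R : comNzRingType) (I : Type) (r : seq I) (P : pred I)
    (F : I -> fps R) n :
  fps_coef (\sum_(i <- r | P i) F i) n = \sum_(i <- r | P i) fps_coef (F i) n.
Proof. exact: (big_morph (fun f => fps_coef f n)). Qed.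

Lemma fps_coefXM0 (R : comNzRingType) (f : fps R) : fps_coef (fpsX * f) 0 = 0.
Proof. by rewrite /= big_ord1 mul0r. Qed.

Lemma fps_coefXMS (R : comNzRingType) (f : fps R) n :
  fps_coef (fpsX * f) n.+1 = fps_coef f n.
Proof.
rewrite /= big_ord_recl /= mul0r add0r big_ord_recl /= mul1r subSS subn0.
by rewrite big1 ?addr0 // => i _; rewrite mul0r.
Qed.

(** The letter [a] is not counted in the length, so the constant coefficient is 1. *)
Definition path_gf {T : finType} (e : rel T) (a : T) : fps rat :=
  FPS (fun n => #|[set w : n.-tuple T | path e a w]|%:R).

Lemma path_gfE (T : finType) (e : rel T) (a : T) :
  path_gf e a = 1 + fpsX * \sum_(b | e a b) path_gf e b.
Proof.
have coefD (f g : fps rat) m :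
  fps_coef (f + g) m = fps_coef f m + fps_coef g m by [].
apply: fpsP => -[|n]; rewrite coefD.
  by rewrite fps_coefXM0 addr0 /= card_path_tuple0.
by rewrite fps_coefXMS fps_coef_sum /= card_path_tupleS natr_sum add0r.
Qed.

Definition even_up_rel {k} : rel 'I_k :=
  fun a b => odd (letter a) || (letter a <= letter b)%N.

Lemma weakly_even_up_sorted k n (w : n.-tuple 'I_k) :
  weakly_even_up w = sorted even_up_rel w.
Proof.
(* The default letter [ord0] used below exists only for a nonempty alphabet. *)
case: k w => [|k] w.
  by case: n w => [|n] w; [rewrite tuple0; apply/forallP => -[] | case: (thead w)].
apply/forallP/(sortedP ord0) => [wP i | wP i].
  rewrite size_tuple => lt_in.
  have /forallP/(_ (Ordinal lt_in)) := wP (Ordinal (ltnW lt_in)).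
  by rewrite /= eqxx /= !(tnth_nth ord0) implyNb.
apply/forallP => j; apply/implyP => /andP[/eqP ji ev].
have := wP i; rewrite size_tuple -ji ltn_ord => /(_ isT).
by rewrite /even_up_rel !(tnth_nth ord0) in ev * => /orP[od|//]; rewrite od in ev.
Qed.

(** An odd letter does not constrain its successor, so any weakly even-up word may follow it. *)
Lemma path_odd_weakly_even_up {k} (a : 'I_k) : odd (letter a) ->
  path_gf even_up_rel a = weakly_even_up_gf k.
Proof.
move=> odd_a; apply: fpsP => n /=; congr (_%:R); apply: eq_card => w.
rewrite !inE weakly_even_up_sorted; case: (val w) => //= b s.
by rewrite /even_up_rel odd_a.
Qed.

(** Induction on [j], one odd and one even index per step. The coefficient of [A] on the right is
    the telescoped sum of [x * (1 - x) ^+ i] for [i] from 1 to [j]. Multiplying by [1 - x] instead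
    of dividing keeps this valid in any commutative ring. *)
Lemma two_step_recurrence (R : comPzRingType) (x A : R) (T : nat -> R) k :
  T 1%N = A ->
  (forall c, (0 < c <= k)%N ->
     T c = T c.+1 + x * (if odd c then A else T c)) ->
  forall j, (j.*2 <= k)%N ->
    (1 - x) ^+ j * A = T j.*2.+1 + A * (1 - x - (1 - x) ^+ j.+1).
Proof.
move=> T1 TE; elim=> [|j IH] lejk; first by rewrite T1 expr0 expr1; ring.
have Todd := TE j.*2.+1; have Teven := TE j.*2.+2.
rewrite /= odd_double /= in Todd Teven.
rewrite exprS -mulrA IH; last by lia.
rewrite doubleS mulrDr Todd; last by lia.
have -> : T j.*2.+3 = (1 - x) * T j.*2.+2.
  by rewrite mulrBl mul1r {1}Teven; [ring | lia].
by rewrite !exprS; ring.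
Qed.

Theorem theorem5 (k : nat) (hk : (2 <= k)%N) :
  weakly_even_up_gf k =
    if ~~ odd k then
      1 / ((1 - fpsX) ^+ ((k + 2) %/ 2) + (1 - fpsX) ^+ ((k + 2) %/ 2 - 1)
           + fpsX - 1)
    else
      1 / ((1 - fpsX) ^+ ((k + 1) %/ 2) + (1 - fpsX) ^+ ((k + 1) %/ 2 - 1)
           - 1).
Proof.
pose P := path_gf (@even_up_rel k); set A := weakly_even_up_gf k.
pose T c : fps rat := 1 + fpsX * \sum_(b : 'I_k | (c <= letter b)%N) P b.
have Ttop : T k.+1 = 1.
  rewrite /T big1 ?mulr0 ?addr0 // => b.
  by rewrite /letter ltnS leqNgt ltn_ord.
have T1 : T 1%N = A.
  have k_gt0 : (0 < k)%N by lia.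
  (* [Ordinal k_gt0] encodes the letter 1, which is odd and may precede every letter. *)
  rewrite /A -(path_odd_weakly_even_up (Ordinal k_gt0)) // path_gfE /T.
  by congr (1 + _ * _); apply: eq_bigl.
have TE c : (0 < c <= k)%N -> T c = T c.+1 + fpsX * (if odd c then A else T c).
  case: c => // c /= lt_ck; pose a := Ordinal lt_ck.
  (* The letter of [a] is [c.+1]; when it is even, its possible successors are exactly the letters
     summed in [T c.+1]. *)
  have -> : (if ~~ odd c then A else T c.+1) = P a.
    case: ifP => [oddc | evenc]; first by rewrite /P path_odd_weakly_even_up.
    rewrite /P path_gfE /T; congr (1 + _ * _); apply: eq_bigl => b.
    by rewrite /even_up_rel /letter /= evenc.
  rewrite /T (bigD1 a) //= mulrDr addrCA [RHS]addrC; congr (_ + (_ + _ * _)).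
  apply: eq_bigl => b; rewrite /letter !ltnS ltn_neqAle andbC eq_sym.
  by rewrite -val_eqE.
have half_le : (k./2.*2 <= k)%N by lia.
have main := two_step_recurrence _ _ _ _ _ T1 TE _ half_le.
(* This identity also shows that the denominator is invertible. *)
have inv D : D * A = 1 -> A = 1 / D by move=> DA; rewrite div1r (mulr1_eq DA).
case: ifP => parity; apply: inv.
  have -> : ((k + 2) %/ 2 = k./2.+1)%N by lia.
  have dk : k./2.*2 = k by lia.
  rewrite dk Ttop in main; rewrite subn1 /= -addrA mulrDl mulrDl main; ring.
have -> : ((k + 1) %/ 2 = k./2.+1)%N by lia.
have dk : k./2.*2.+1 = k by lia.
have oddk : odd k by lia.
(* For odd [k] the two-step iteration stops at [T k]; one more odd step gives
   [T k = 1 + fpsX * A]. *)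
rewrite dk TE ?leqnn ?andbT ?oddk ?Ttop in main; last by lia.
rewrite subn1 /= mulrBl mulrDl main; ring.
Qed.
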